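(* Let $\mathscr S$ be an operator system and $\mathscr T$ a unital $C^*$-algebra. Let $(k_j,f_j,s_j)$, $j=1,\dots,N$, be matrix tests, and let $c_1,\dots,c_N\in\mathbb C$ be complex numbers, not all zero. Write $c_j=r_je^{i\theta_j}$ with $r_j\ge 0$, $\theta_j\in\mathbb R$, and set $R:=\sum_{j=1}^N r_j>0$. Define $$K:=\sum_{j=1}^N k_j,\qquad S:=\mathrm{diag}\big(e^{i\theta_1}s_1,\dots,e^{i\theta_N}s_N\big)\in M_K(\mathscr S),$$ $$F:=\sum_{j=1}^N\lambda_j\,(f_j\circ\pi_j),\qquad \lambda_j:=\frac{r_j}{R}\in[0,1],\quad \sum_{j=1}^N\lambda_j=1,$$ where $\pi_j:M_K(\mathscr T)\to M_{k_j}(\mathscr T)$ extracts the $j$th diagonal block (with respect to the block decomposition $K=k_1+\dots+k_N$). Then $(K,F,S)$ is a matrix test and, for every $\Phi\in\mathcal E$, $$F\big(\Phi_K(S)\big)=\frac1R\sum_{j=1}^N c_j\,f_j\big(\Phi_{k_j}(s_j)\big),$$ that is, $\ell_{K,F,S}(\Phi)=\frac1R\sum_{j=1}^N c_j\,\ell_{k_j,f_j,s_j}(\Phi)$.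
   Context: $\mathrm{CP}(\mathscr S,\mathscr T)$ is the set of all completely positive linear maps $\mathscr S\to\mathscr T$, and $\mathcal E=\mathrm{span}_{\mathbb C}(\mathrm{CP}(\mathscr S,\mathscr T))$, a complex vector space of linear maps $\mathscr S\to\mathscr T$. For a linear map $\Phi:\mathscr S\to\mathscr T$ and $k\in\mathbb N$ ($k\ge1$), $\Phi_k:M_k(\mathscr S)\to M_k(\mathscr T)$ is $\Phi_k([s_{ij}])=[\Phi(s_{ij})]$. A matrix test is a triple $(k,f,s)$ with $k\in\mathbb N$, $f$ a state on $M_k(\mathscr T)$ (positive linear functional with $f(\mathbb 1)=1$), and $s\in M_k(\mathscr S)$. For a matrix test, $\ell_{k,f,s}:\mathcal E\to\mathbb C$ is $\ell_{k,f,s}(\Phi)=f(\Phi_k(s))$. *)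

(* Defs.v *)
From HB Require Import structures.
From mathcomp Require Import all_boot all_order all_algebra.
From mathcomp Require Import classical_sets reals trigo.
From mathcomp Require Import complex.

Set Implicit Arguments.
Unset Strict Implicit.
Unset Printing Implicit Defensive.

Import Order.TTheory GRing.Theory Num.Theory.

Local Open Scope classical_set_scope.
Local Open Scope ring_scope.
Local Open Scope complex_scope.

(* Unital C*-algebras. The norm is a field of the mixin because the library has
   no join of rings with normed modules: declaring this structure on top of
   [CompleteNormedModule] is rejected by the hierarchy. [GRing.Algebra] supplies
   a unit with 1 != 0. *)
HB.mixin Record isCstarAlgebra (R : realType) A of GRing.Algebra R[i] A := {
  star : A -> A;
  cnorm : A -> R;
  starK : involutive star;
  starD : {morph star : x y / x + y};
  starZ : forall (a : R[i]) (x : A), star (a *: x) = a^* *: star x;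
  starM : forall x y : A, star (x * y) = star y * star x;
  cnorm_eq0 : forall x : A, cnorm x = 0 -> x = 0;
  cnormD : forall x y : A, cnorm (x + y) <= cnorm x + cnorm y;
  cnormZ : forall (a : R[i]) (x : A), (cnorm (a *: x))%:C = `|a| * (cnorm x)%:C;
  cnormM : forall x y : A, cnorm (x * y) <= cnorm x * cnorm y;
  cnorm_starM : forall x : A, cnorm (star x * x) = cnorm x ^+ 2;
  cnorm_complete : forall u : nat -> A,
    (forall e : R, 0 < e -> exists n, forall p q, (n <= p)%N -> (n <= q)%N ->
      cnorm (u p - u q) < e) ->
    exists l : A, forall e : R, 0 < e -> exists n, forall p, (n <= p)%N ->
      cnorm (u p - l) < e
}.

#[short(type="cstarAlgType")]
HB.structure Definition CstarAlgebra (R : realType) :=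
  {A of isCstarAlgebra R A & GRing.Algebra R[i] A}.

Section MatrixOrder.
Variables (R : realType) (A : cstarAlgType R).

Definition adjmx m n (X : 'M[A]_(m, n)) : 'M[A]_(n, m) := map_mx star X^T.

(* The positive elements of the C*-algebra M_k(A). *)
Definition mxpos k (X : 'M[A]_k) : Prop :=
  exists Y : 'M[A]_k, X = adjmx Y *m Y.

End MatrixOrder.

(* The library's [lmodType] structure on ['M[V]_k] has scalars in V (when V is a
   ring), so the complex scalar multiplication of M_k(V) is defined separately. *)
Definition cscale (R : realType) (V : lmodType R[i]) m n (a : R[i])
  (X : 'M[V]_(m, n)) : 'M[V]_(m, n) := map_mx ( *:%R a) X.

(* A subspace (given by the predicate [os_pred], with [os_sort] the
   corresponding subtype) of a unital C*-algebra, which contains the unit and is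
   closed under the involution. *)
Record opSystem (R : realType) := OpSystem {
  os_ambient : cstarAlgType R;
  os_pred : pred os_ambient;
  os_sort :> subLmodType os_pred;
  os_one : 1 \in os_pred;
  os_star : forall x, x \in os_pred -> star x \in os_pred
}.

(* The order on M_k(S) is inherited from M_k of the ambient C*-algebra. *)
Definition os_mxpos (R : realType) (S : opSystem R) k (s : 'M[S]_k) : Prop :=
  mxpos (map_mx (val : S -> os_ambient S) s).

Section CompletelyPositive.
Variables (R : realType) (S : opSystem R) (T : cstarAlgType R).

Definition ampl (Phi : {linear S -> T}) k (s : 'M[S]_k) : 'M[T]_k :=
  map_mx Phi s.

Definition CP : set {linear S -> T} :=
  [set Phi | forall k (s : 'M[S]_k), (0 < k)%N ->
    os_mxpos s -> mxpos (ampl Phi s)].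

Definition CPspan : set {linear S -> T} :=
  [set Phi | exists (m : nat) (a : 'I_m -> R[i]) (Psi : 'I_m -> {linear S -> T}),
    (forall i, CP (Psi i)) /\
    (forall x, Phi x = \sum_(i < m) a i *: Psi i x)].

Record is_state k (f : 'M[T]_k -> R[i]) : Prop := IsState {
  state_add : forall X Y, f (X + Y) = f X + f Y;
  state_scale : forall a X, f (cscale a X) = a * f X;
  state_pos : forall X, mxpos X -> 0 <= f X;
  state_one : f 1%:M = 1
}.

Definition is_matrix_test k (f : 'M[T]_k -> R[i]) (s : 'M[S]_k) : Prop :=
  (0 < k)%N /\ is_state f.

Definition ell k (f : 'M[T]_k -> R[i]) (s : 'M[S]_k) (Phi : {linear S -> T}) :
  R[i] := f (ampl Phi s).

End CompletelyPositive.

Definition expi (R : realType) (t : R) : R[i] := cos t +i* sin t.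

(* Main.v *)
(* The only point which is not bookkeeping is the positivity of F.  A diagonal
   block of Y^* Y is Z^* Z, where Z is a block column of Y, hence rectangular.
   Z^* Z is the sum of the z^* z over the rows z of Z, and each z^* z is the Gram
   matrix of a square matrix, namely z completed with zero rows. *)
Require Import Defs.
From mathcomp Require Import all_boot all_order all_algebra.
From mathcomp Require Import classical_sets reals trigo.
From mathcomp Require Import complex.
Import Order.TTheory GRing.Theory Num.Theory.
Local Open Scope ring_scope.
Local Open Scope complex_scope.

Section Positivity.
Variables (R : realType) (A : cstarAlgType R).

Lemma star0 : star (0 : A) = 0.
Proof. by rewrite -[X in star X](scale0r (0 : A)) starZ rmorph0 scale0r. Qed.

Lemma gram_mxE m n (Z : 'M[A]_(m, n)) i j :
  (adjmx Z *m Z) i j = \sum_p star (Z p i) * Z p j.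
Proof. by rewrite mxE; apply: eq_bigr => p _; rewrite !mxE. Qed.

Lemma gram_mx_sum_rows m n (Z : 'M[A]_(m, n)) :
  adjmx Z *m Z = \sum_p adjmx (row p Z) *m row p Z.
Proof.
apply/matrixP => i j; rewrite summxE gram_mxE; apply: eq_bigr => p _.
by rewrite gram_mxE big_ord1 !mxE.
Qed.

Lemma mxpos_gram_row k (z : 'rV[A]_k) : (0 < k)%N -> mxpos (adjmx z *m z).
Proof.
(* Positivity of [k] supplies the row index 0 in which [z] is placed. *)
case: k z => // k z _; pose Y : 'M[A]_k.+1 := \matrix_(p, j) (z 0 j *+ (p == 0)).
exists Y; apply/matrixP => i j; rewrite !gram_mxE big_ord1 big_ord_recl.
rewrite big1 ?addr0 => [|p _]; first by rewrite !mxE.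
by rewrite !mxE /= mulr0n mulr0.
Qed.

Lemma submxblock_gram N (k : 'I_N -> nat) (Y : 'M[A]_(\sum_j k j)) j :
  submxblock (adjmx Y *m Y) j j = adjmx (submxrow Y j) *m submxrow Y j.
Proof.
apply/matrixP => a b; rewrite gram_mxE /submxblock mxE gram_mxE.
by apply: eq_bigr => p _; rewrite !mxE.
Qed.

End Positivity.

Section States.
Variables (R : realType) (T : cstarAlgType R).

Lemma state_sum k (f : 'M[T]_k -> R[i]) I (e : seq I) (X : I -> 'M[T]_k) :
  is_state f -> f (\sum_(i <- e) X i) = \sum_(i <- e) f (X i).
Proof.
move=> fS; apply: (big_morph f (state_add fS)).
(* Additivity alone gives [f 0 = 0], by cancelling in [f 0 + f 0 = f 0]. *)
by apply: (addrI (f 0)); rewrite -(state_add fS) !addr0.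
Qed.

(** Additivity of [f] moves the sum over rows outside, so [state_pos] is applied to one row at a
    time and nonnegative scalars are added instead of positive matrices. *)
Lemma state_gram_ge0 m k (f : 'M[T]_k -> R[i]) (Z : 'M[T]_(m, k)) :
  (0 < k)%N -> is_state f -> 0 <= f (adjmx Z *m Z).
Proof.
move=> k_gt0 fS; rewrite gram_mx_sum_rows (state_sum _ _ _ _ _ fS).
by apply: sumr_ge0 => p _; apply: (state_pos fS); apply: mxpos_gram_row.
Qed.

Lemma is_state_convex_blocks N (k : 'I_N -> nat)
    (f : forall j, 'M[T]_(k j) -> R[i]) (lambda : 'I_N -> R) :
  (forall j, (0 < k j)%N) -> (forall j, is_state (f j)) ->
  (forall j, 0 <= lambda j) -> \sum_j lambda j = 1 ->
  is_state (fun X : 'M[T]_(\sum_j k j) =>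
    \sum_j (lambda j)%:C * f j (submxblock X j j)).
Proof.
move=> k_gt0 fS l_ge0 l_sum; split=> [X Y|a X|_ [Y ->]|].
- rewrite -big_split; apply: eq_bigr => j _ /=.
  by rewrite submxblockD (state_add (fS j)) mulrDr.
- rewrite mulr_sumr; apply: eq_bigr => j _.
  (* Block extraction only reindexes entries, hence commutes with the entrywise map [cscale]. *)
  by rewrite /submxblock -map_mxsub (state_scale (fS j)) mulrCA.
- apply: sumr_ge0 => j _; apply: mulr_ge0; first by rewrite lecR.
  by rewrite submxblock_gram; apply: state_gram_ge0.
(* The unit matrix is the block diagonal of unit matrices, and the 1 on the right is expanded as the
   sum of the weights, so both sides agree term by term. *)
- rewrite -mxdiagZ -[RHS](rmorph1 (real_complex R)) -l_sum rmorph_sum.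
  apply: eq_bigr => j _.
  by rewrite submxblock_diag (state_one (fS j)) mulr1.
Qed.

End States.

(** The amplification acts entrywise, so it respects blocks, and linearity of [Phi] releases the
    scalar. This lets the phases of the [c j] be stored in the matrix, leaving only the nonnegative
    moduli as weights in the functional. *)
Lemma ampl_submxblock_cscale_mxdiag (R : realType) (S : opSystem R)
    (T : cstarAlgType R) (Phi : {linear S -> T}) N (k : 'I_N -> nat)
    (a : 'I_N -> R[i]) (s : forall j, 'M[S]_(k j)) j :
  submxblock (ampl Phi (\mxdiag_(i < N) cscale (a i) (s i))) j j =
    cscale (a j) (ampl Phi (s j)).
Proof.
rewrite /submxblock /ampl -map_mxsub -/(submxblock _ j j) submxblock_diag.
by apply/matrixP => p q; rewrite !mxE linearZ.
Qed.

Theorem lemma3p1 (R : realType) (S : opSystem R) (T : cstarAlgType R)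
    (N : nat) (k : 'I_N -> nat)
    (f : forall j : 'I_N, 'M[T]_(k j) -> R[i])
    (s : forall j : 'I_N, 'M[S]_(k j))
    (c : 'I_N -> R[i]) (r theta : 'I_N -> R)
    (htest : forall j, is_matrix_test (f j) (s j))
    (hc : exists j, c j != 0)
    (hr : forall j, 0 <= r j)
    (hpolar : forall j, c j = (r j)%:C * expi (theta j)) :
  let Rsum : R := \sum_(j < N) r j in
  let lambda : 'I_N -> R := fun j => r j / Rsum in
  let K : nat := (\sum_(j < N) k j)%N in
  let Sdiag : 'M[S]_K := \mxdiag_(j < N) cscale (expi (theta j)) (s j) in
  let F : 'M[T]_K -> R[i] :=
    fun X => \sum_(j < N) (lambda j)%:C * f j (submxblock X j j) in
  [/\ 0 < Rsum,
      (forall j, 0 <= lambda j <= 1) /\ \sum_(j < N) lambda j = 1,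
      is_matrix_test F Sdiag,
      forall Phi : {linear S -> T}, CPspan Phi ->
        F (ampl Phi Sdiag) =
          (Rsum^-1)%:C * \sum_(j < N) c j * f j (ampl Phi (s j)) &
      forall Phi : {linear S -> T}, CPspan Phi ->
        ell F Sdiag Phi =
          (Rsum^-1)%:C * \sum_(j < N) c j * ell (f j) (s j) Phi].
Proof.
move=> Rsum lambda K Sdiag F.
have Rsum_gt0 : 0 < Rsum.
  rewrite lt_neqAle sumr_ge0 // andbT eq_sym.
  (* A vanishing sum of nonnegative moduli forces every [r j], hence every [c j], to be zero. *)
  case: hc => j; apply: contraNneq => /eqP; rewrite psumr_eq0 // => /allP.
  by move=> /(_ j (mem_index_enum j)) /eqP rj0; rewrite hpolar rj0 mul0r.
have lambda_ge0 j : 0 <= lambda j by rewrite divr_ge0 // ltW.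
have lambda_sum : \sum_(j < N) lambda j = 1.
  by rewrite -mulr_suml divff ?gt_eqF.
have lambda_le1 j : lambda j <= 1.
  by rewrite -lambda_sum (bigD1 j) //= lerDl sumr_ge0.
have k_gt0 j : (0 < k j)%N by case: (htest j).
have f_state j : is_state (f j) by case: (htest j).
have K_gt0 : (0 < K)%N.
  (* The index of a nonzero coefficient shows that there is at least one block. *)
  by case: hc => j _; rewrite /K (bigD1 j) //= addn_gt0 k_gt0.
have FE (Phi : {linear S -> T}) : F (ampl Phi Sdiag) =
    (Rsum^-1)%:C * \sum_(j < N) c j * f j (ampl Phi (s j)).
  rewrite mulr_sumr; apply: eq_bigr => j _.
  rewrite ampl_submxblock_cscale_mxdiag (state_scale (f_state j)) hpolar.
  (* The modulus from [lambda j] and the phase from [Sdiag] recombine into [c j], leaving the factor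
     [Rsum^-1]. *)
  by rewrite rmorphM /= [in RHS]mulrA [in RHS]mulrA [(r j)%:C * _]mulrC !mulrA.
split=> //.
- by split=> // j; rewrite lambda_ge0 lambda_le1.
- by split=> //; apply: is_state_convex_blocks.
- by move=> Phi _; apply: FE.
Qed.
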